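(* Let $M=(E,\mathcal I)$ be a loopless matroid with rank function $r$ and base family $\mathcal B$, let $\widetilde{\mathcal B}$ be a Fulkerson dual family of $\mathcal B$, let $\mu^*$ be an optimal probability mass function for $\mathrm{MEO}(\mathcal B)$, and let $\eta^*(e)=\sum_{B\ni e}\mu^*(B)$, which is the optimal density for $\mathrm{Mod}_2(\widetilde{\mathcal B})$. Let $\eta^*_{\min}=\min_{e\in E}\eta^*(e)$ and $Y=E_{\min}=\{e\in E:\eta^*(e)=\eta^*_{\min}\}$. Then: (1) $Y$ is a complement-Beurling set, i.e. $\eta^*(Y)=r(Y)$; (2) $\mathrm{cl}(Y)=Y$; (3) $\eta^*_{\min}=r(Y)/|Y|>0$; (4) $\eta^*_{\min}=1/D(M)$; (5) the matroid $M\setminus(E\setminus E_{\min})$ (the restriction of $M$ to $E_{\min}$) is homogeneous.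
   Context: A matroid $M=(E,\mathcal I)$ on a finite set $E$ has rank function $r$, base family $\mathcal B$, closure $\mathrm{cl}(Z)=\{y:r(Z\cup\{y\})=r(Z)\}$. Standing assumption: $r(E)>0$. $M\setminus Z$ is the deletion: matroid on $E\setminus Z$ whose independent sets are the independent sets of $M$ inside $E\setminus Z$. Fractional arboricity: $D(M)=\max\{|X|/r(X):X\subseteq E,\ r(X)>0\}$. Bases are identified with indicator vectors; $\eta(A)=\sum_{e\in A}\eta(e)$. For $\Gamma\subseteq\mathbb R^F_{\ge0}$ ($F$ finite), $\mathrm{Adm}(\Gamma)=\{\rho\in\mathbb R^F_{\ge0}:\sum_e\gamma(e)\rho(e)\ge1\ \forall\gamma\in\Gamma\}$, $\mathrm{Mod}_2(\Gamma)=\min\{\sum_e\rho(e)^2:\rho\in\mathrm{Adm}(\Gamma)\}$ with unique minimizer (optimal density). $\mathrm{BL}(K)=\{\eta\ge0:\eta^T\rho\ge1\ \forall\rho\in K\}$; $\widetilde{\mathcal B}$ is a Fulkerson dual family of $\mathcal B$ if $\mathrm{Adm}(\widetilde{\mathcal B})=\mathrm{BL}(\mathrm{Adm}(\mathcal B))$. $\mathrm{MEO}(\mathcal B)=\min_\mu\sum_{B,B'}\mu(B)\mu(B')|B\cap B'|$ over pmfs $\mu$ on $\mathcal B$. A matroid $N$ is homogeneous if the optimal density for $\mathrm{Mod}_2$ of a Fulkerson dual family of its base family is constant. *)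

(* Defs.v *)
From mathcomp Require Import all_boot all_order all_algebra.
From mathcomp Require Import classical_sets reals.

Set Implicit Arguments.
Unset Strict Implicit.
Unset Printing Implicit Defensive.

Import Order.TTheory GRing.Theory Num.Theory.

Local Open Scope ring_scope.

(* The ground set is the whole finite type [E]; a matroid on a subset of [E]
   is a matroid on the corresponding subtype (see [deletion]). *)
Record matroid (E : finType) := Matroid {
  indep : pred {set E};
  indep0 : indep (@finset.set0 E);
  indepS : forall I J : {set E}, J \subset I -> indep I -> indep J;
  indep_aug : forall I J : {set E}, indep I -> indep J -> (#|I| < #|J|)%N ->
    exists2 e : E, e \in J :\: I & indep (e |: I)
}.

Section Matroid.
Variables (E : finType) (M : matroid E).

Definition rank (X : {set E}) : nat :=
  \max_(I : {set E} | indep M I && (I \subset X)) #|I|.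

Definition base (B : {set E}) : bool := maxset (indep M) B.

Definition cl (Z : {set E}) : {set E} :=
  [set y | rank (y |: Z) == rank Z]%SET.

Definition loopless : Prop := forall e : E, indep M [set e]%SET.

Section Deletion.
Variable Z : {set E}.
Let F := {e : E | e \notin Z}.

Definition deletion_indep (I : {set F}) : bool := indep M (val @: I)%SET.

Lemma deletion_indep0 : deletion_indep finset.set0.
Proof. by rewrite /deletion_indep imset0 indep0. Qed.

Lemma deletion_indepS (I J : {set F}) :
  J \subset I -> deletion_indep I -> deletion_indep J.
Proof. by move=> sJI; apply: indepS; apply: imsetS. Qed.

Lemma deletion_indep_aug (I J : {set F}) :
  deletion_indep I -> deletion_indep J -> (#|I| < #|J|)%N ->
  exists2 e : F, e \in J :\: I & deletion_indep (e |: I).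
Proof.
move=> iI iJ ltIJ.
have [|e] := indep_aug iI iJ; first by rewrite !card_imset //; apply: val_inj.
rewrite inE => /andP[eI /imsetP[f fJ def_e]] ieI.
exists f; first by rewrite inE fJ andbT; apply: contra eI => fI;
  rewrite def_e imset_f.
by rewrite /deletion_indep imsetU1 -def_e.
Qed.

Definition deletion : matroid F :=
  Matroid deletion_indep0 deletion_indepS deletion_indep_aug.
End Deletion.

Variable R : realType.

(* All ratios are nonnegative, so the default value 0 does not affect the
   maximum as soon as some X has positive rank. *)
Definition fractional_arboricity : R :=
  \big[Num.max/0]_(X : {set E} | (0 < rank X)%N) (#|X|%:R / (rank X)%:R).

Definition base_family : set {ffun E -> R} :=
  [set [ffun e => (e \in B)%:R] | B in [set B : {set E} | base B]]%classic.

Definition is_base_pmf (mu : {ffun {set E} -> R}) : Prop :=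
  [/\ forall B, 0 <= mu B,
      forall B, ~~ base B -> mu B = 0
    & \sum_(B : {set E} | base B) mu B = 1].

Definition expected_overlap (mu : {ffun {set E} -> R}) : R :=
  \sum_(B : {set E} | base B) \sum_(B' : {set E} | base B')
     mu B * mu B' * #|B :&: B'|%:R.

Definition MEO_optimal (mu : {ffun {set E} -> R}) : Prop :=
  is_base_pmf mu /\
  forall nu, is_base_pmf nu -> expected_overlap mu <= expected_overlap nu.

Definition usage (mu : {ffun {set E} -> R}) : {ffun E -> R} :=
  [ffun e => \sum_(B : {set E} | base B && (e \in B)) mu B].

End Matroid.

Arguments base_family {E} M R _.

Section Modulus.
Variables (R : realType) (F : finType).
Implicit Types (Gamma Gammat K : set {ffun F -> R}) (rho eta : {ffun F -> R}).

Definition Adm Gamma : set {ffun F -> R} :=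
  [set rho | (forall e, 0 <= rho e) /\
     forall gamma, Gamma gamma -> 1 <= \sum_e gamma e * rho e]%classic.

Definition BL K : set {ffun F -> R} :=
  [set eta | (forall e, 0 <= eta e) /\
     forall rho, K rho -> 1 <= \sum_e eta e * rho e]%classic.

Definition Mod2_optimal Gamma rho : Prop :=
  Adm Gamma rho /\
  forall rho', Adm Gamma rho' -> \sum_e rho e ^+ 2 <= \sum_e rho' e ^+ 2.

Definition Fulkerson_dual Gamma Gammat : Prop :=
  (forall gamma, Gammat gamma -> forall e, 0 <= gamma e) /\
  Adm Gammat = BL (Adm Gamma).

Definition is_minimum eta (m : R) : Prop :=
  (exists e, eta e = m) /\ forall e, m <= eta e.

End Modulus.

(* The choice of the dual family is immaterial: all Fulkerson dual families of
   a given family have the same admissible set, hence the same optimal density;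
   [Adm (base_family N R)] is always one of them. *)
Definition homogeneous (R : realType) (F : finType) (N : matroid F) : Prop :=
  exists (Gammat : set {ffun F -> R}) (eta : {ffun F -> R}),
    [/\ Fulkerson_dual (base_family N R) Gammat,
        Mod2_optimal Gammat eta
      & exists c : R, forall e, eta e = c].

(* Main.v *)
(** The overlap of [mu] is the squared norm of its usage [eta], so first-order
    optimality of [mu] says that every base has [eta]-weight at least [|eta|^2],
    with equality for the bases charged by [mu]. Hence [eta / |eta|^2] is
    admissible for the bases, and pairing it with an element of the blocker shows
    that [eta] is the projection of the origin on [Adm Bt]. The bases charged by
    [mu] have minimal [eta]-weight, so by the greedy exchange argument each of
    them meets the argmin set [Y] in exactly [r(Y)] elements; averaging over [mu]
    gives [eta(Y) = r(Y)], while [eta(X) <= r(X)] for every [X]. The traces of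
    these bases on [Y] are bases of the restriction to [Y], whose optimal density
    is therefore the constant [r(Y)/|Y|]. *)
Require Import Defs.
From mathcomp Require Import all_boot all_order all_algebra.
From mathcomp Require Import classical_sets reals.
From mathcomp Require Import fintype finset ring lra.
Import Order.TTheory GRing.Theory Num.Theory.
Local Open Scope ring_scope.

Set Implicit Arguments.
Unset Strict Implicit.
Unset Printing Implicit Defensive.

(** * Rank, bases and minimum-weight bases *)

Section MatroidTheory.
Variables (E : finType) (M : matroid E).
Implicit Types I J K B X : {set E}.

Lemma card_leq_rank I X : indep M I -> I \subset X -> (#|I| <= rank M X)%N.
Proof.
move=> iI sIX; rewrite /rank.
by apply: (@leq_bigmax_cond _ _ (fun I : {set E} => #|I|)); rewrite iI.
Qed.

Lemma rank_witness X :
  exists I, [/\ indep M I, I \subset X & #|I| = rank M X].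
Proof.
have P0 : (0 < #|[pred I : {set E} | indep M I && (I \subset X)]|)%N.
  by apply/card_gt0P; exists set0; rewrite inE indep0 sub0set.
have [I] := @eq_bigmax_cond _ _ (fun I : {set E} => #|I|) P0.
by rewrite inE => /andP[iI sIX] eqI; exists I; split; rewrite // -eqI.
Qed.

Lemma rank_loopless_gt0 X e : loopless M -> e \in X -> (0 < rank M X)%N.
Proof.
move=> lM eX; rewrite -(cards1 e); apply: card_leq_rank (lM e) _.
by rewrite sub1set.
Qed.

(** Iterated augmentation. The bound by [I :|: J] records where the new elements come from, which
    the exchange argument relies on. *)
Lemma indep_extend I J : indep M I -> indep M J -> (#|I| <= #|J|)%N ->
  exists K, [/\ indep M K, I \subset K, K \subset I :|: J & #|K| = #|J|].
Proof.
have [n] := ubnP (#|J| - #|I|)%N; elim: n I => // n IHn I ltn iI iJ leIJ.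
have [eqIJ|ltIJ] := eqVneq #|I| #|J|.
  by exists I; split=> //; apply: subsetUl.
have {}ltIJ : (#|I| < #|J|)%N by rewrite ltn_neqAle ltIJ.
have [e /setDP[eJ eI] ieI] := indep_aug iI iJ ltIJ.
have cardeI : #|e |: I| = #|I|.+1 by rewrite cardsU1 eI.
have [||K [iK sIK sKJ cardK]] := IHn (e |: I) _ ieI iJ; rewrite ?cardeI //.
  by rewrite subnS -ltnS prednK // subn_gt0.
exists K; split=> //; first exact: subset_trans (subsetUr _ _) sIK.
apply: subset_trans sKJ _; rewrite subUset subsetUr andbT.
by rewrite subUset subsetUl andbT sub1set in_setU eJ orbT.
Qed.

Lemma baseE B : base M B = indep M B && (#|B| == rank M [set: E]).
Proof.
apply/maxsetP/andP=> [[iB maxB]|[iB /eqP cardB]].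
  split=> //; have [J [iJ _ cardJ]] := rank_witness [set: E].
  rewrite eqn_leq card_leq_rank ?subsetT //= -cardJ leqNgt.
  apply/negP=> ltBJ; have [e /setDP[_ /negP eB] ieB] := indep_aug iB iJ ltBJ.
  by apply: eB; rewrite -(maxB _ ieB (subsetUr _ _)) setU11.
split=> // C iC sBC; apply/eqP; rewrite eq_sym eqEcard sBC cardB.
exact: card_leq_rank iC (subsetT _).
Qed.

Lemma base_indep B : base M B -> indep M B.
Proof. by rewrite baseE => /andP[]. Qed.

Lemma card_base B : base M B -> #|B| = rank M [set: E].
Proof. by rewrite baseE => /andP[_ /eqP]. Qed.

Lemma card_baseI_leq B X : base M B -> (#|B :&: X| <= rank M X)%N.
Proof.
move=> bB; apply: card_leq_rank (subsetIr _ _).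
exact: indepS (subsetIl _ _) (base_indep bB).
Qed.

(* Extending a maximal independent subset of [Y] inside [B] only trades elements
   of [B] outside [Y] for elements of [Y]. *)
Lemma min_weight_base_argmin (R : realDomainType) (w : E -> R) (c : R) B :
    let Y := [set e | w e == c] in
    base M B -> (forall e, c <= w e) ->
    (forall B', base M B' -> \sum_(e in B) w e <= \sum_(e in B') w e) ->
  #|B :&: Y| = rank M Y.
Proof.
move=> Y bB c_le minB; apply/eqP; rewrite eqn_leq card_baseI_leq //= leqNgt.
apply/negP=> ltBY; have [J [iJ sJY cardJ]] := rank_witness Y.
have [|K [iK sJK sKJB cardK]] := indep_extend iJ (base_indep bB).
  by rewrite (card_base bB) card_leq_rank ?subsetT.
have bK : base M K by rewrite baseE iK cardK (card_base bB) eqxx.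
have ltKB : (#|K :\: Y| < #|B :\: Y|)%N.
  rewrite -(ltn_add2l #|K :&: Y|) cardsID cardK -[#|B|](cardsID Y) ltn_add2r.
  by rewrite (leq_trans ltBY) // -cardJ subset_leq_card // subsetI sJK.
have sKB : K :\: Y \subset B :\: Y.
  apply/subsetP=> e /setDP[/(subsetP sKJB)/setUP[/(subsetP sJY)->//|eB] eY].
  by rewrite inE eY.
(* Among sets of equal size only the excess over [c] matters, and elements of [Y] have none. *)
have sum_excess (C : {set E}) : #|C| = #|B| ->
    \sum_(e in C) w e = c *+ #|B| + \sum_(e in C :\: Y) (w e - c).
  move=> cardC; rewrite -cardC -sumr_const; apply/eqP.
  rewrite -subr_eq0 opprD addrA -sumrB (big_setID Y) /= big1 ?add0r ?subrr //.
  by move=> e; rewrite !inE => /andP[_ /eqP->]; rewrite subrr.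
(* Such an [f] has positive excess and is absent from [K], so [K] would be strictly lighter than
   [B]. *)
have [f fBK] : exists f, f \in (B :\: Y) :\: (K :\: Y).
  apply/set0Pn; apply: contraTneq ltKB => /eqP; rewrite setD_eq0 -leqNgt.
  exact: subset_leq_card.
have := minB K bK; rewrite !sum_excess // lerD2l; apply/negP; rewrite -ltNge.
rewrite [X in _ < X](big_setID (K :\: Y)) /= (setIidPr sKB) ltrDl.
rewrite (big_setD1 f) //= ltr_pwDl ?sumr_ge0 // => [|e _]; rewrite ?subr_ge0 //.
rewrite subr_gt0 lt_neqAle c_le andbT eq_sym.
by case/setDP: fBK => /setDP[_]; rewrite inE.
Qed.

End MatroidTheory.

(** * The restriction to [Y], as deletion of its complement *)

Section DeletionSetC.
Variables (E : finType) (M : matroid E) (Y : {set E}).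
Implicit Types B J : {set E}.
Local Notation F := {e : E | e \notin ~: Y}.
Local Notation N := (deletion M (~: Y)).

Lemma preimset_valK J : J \subset Y -> val @: (val @^-1: J : {set F}) = J.
Proof.
move=> sJY; apply/setP=> e; apply/imsetP/idP => [[f fJ ->]|eJ].
  by rewrite inE in fJ.
have eY : e \notin ~: Y by rewrite inE negbK (subsetP sJY).
by exists (exist _ e eY); rewrite ?inE.
Qed.

Lemma imset_val_sub (A : {set F}) : val @: A \subset Y.
Proof.
by apply/subsetP=> _ /imsetP[[e /= eY] _ ->]; rewrite inE negbK in eY.
Qed.

Lemma big_preimset_val (R : nmodType) (J : {set E}) (w : E -> R) :
  J \subset Y ->
  \sum_(f in (val @^-1: J : {set F})) w (val f) = \sum_(e in J) w e.
Proof.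
move=> sJY; rewrite -{2}(preimset_valK sJY) big_imset //.
by move=> f g _ _; apply: val_inj.
Qed.

Lemma card_preimset_val J : J \subset Y -> #|val @^-1: J : {set F}| = #|J|.
Proof.
by move=> sJY; rewrite -{2}(preimset_valK sJY) card_imset //; apply: val_inj.
Qed.

Lemma rank_deletionC : rank N [set: F] = rank M Y.
Proof.
apply/eqP; rewrite eqn_leq; apply/andP; split.
  have [I [iI _ <-]] := rank_witness N [set: F].
  by rewrite -(card_imset _ val_inj) card_leq_rank ?imset_val_sub.
have [J [iJ sJY <-]] := rank_witness M Y.
rewrite -(card_preimset_val sJY) card_leq_rank ?subsetT //=.
by rewrite /deletion_indep preimset_valK.
Qed.

Lemma base_deletionC B :
  indep M B -> #|B :&: Y| = rank M Y -> base N (val @^-1: (B :&: Y)).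
Proof.
move=> iB cardBY; rewrite baseE rank_deletionC card_preimset_val ?subsetIr //.
rewrite cardBY eqxx andbT /= /deletion_indep preimset_valK ?subsetIr //.
exact: indepS (subsetIl _ _) iB.
Qed.

End DeletionSetC.

(** * Usage of a pmf on bases, and optimality for the overlap *)

Section Usage.
Variables (R : realType) (E : finType) (M : matroid E).
Implicit Types (mu : {ffun {set E} -> R}) (B X : {set E}).

Lemma sum_indicator (X : {set E}) (f : E -> R) :
  \sum_e (e \in X)%:R * f e = \sum_(e in X) f e.
Proof.
by rewrite [RHS]big_mkcond; apply: eq_bigr => e _; case: ifP; rewrite (mul1r, mul0r).
Qed.

Lemma usage_sum mu (f : E -> R) :
  \sum_e usage M mu e * f e =
  \sum_(B : {set E} | base M B) mu B * \sum_(e in B) f e.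
Proof.
under eq_bigr do rewrite ffunE mulr_suml.
rewrite (exchange_big_dep (base M)) //=; last by move=> e B _ /andP[].
by apply: eq_bigr => B bB; rewrite mulr_sumr; apply: eq_bigl => e; rewrite bB.
Qed.

Lemma usage_sum_set mu X :
  \sum_(e in X) usage M mu e =
  \sum_(B : {set E} | base M B) mu B * #|B :&: X|%:R.
Proof.
rewrite -sum_indicator; under eq_bigr do rewrite mulrC.
rewrite usage_sum; apply: eq_bigr => B _; congr (_ * _).
rewrite -sumr_const [RHS](eq_bigl (fun e => (e \in B) && (e \in X))).
  by rewrite [RHS]big_mkcondr; apply: eq_bigr => e _; case: (e \in X).
by move=> e; rewrite inE.
Qed.

(** [#|B :&: B'|] is the inner product of two indicators, and the usage is the mean indicator. *)
Lemma expected_overlap_usage mu :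
  expected_overlap M mu = \sum_e usage M mu e ^+ 2.
Proof.
under [RHS]eq_bigr do rewrite expr2.
rewrite usage_sum; apply: eq_bigr => B _; rewrite usage_sum_set mulr_sumr.
by apply: eq_bigr => B' _; rewrite mulrA setIC.
Qed.

Lemma usage_ge0 mu e : is_base_pmf M mu -> 0 <= usage M mu e.
Proof. by case=> mu0 _ _; rewrite ffunE sumr_ge0. Qed.

Lemma usage_set_le_rank mu X :
  is_base_pmf M mu -> \sum_(e in X) usage M mu e <= (rank M X)%:R.
Proof.
move=> [mu0 _ mu1]; rewrite usage_sum_set -[leRHS]mul1r -[X in X * _]mu1 mulr_suml.
by apply: ler_sum => B bB; rewrite ler_wpM2l ?ler_nat ?card_baseI_leq.
Qed.

Lemma usage_BL mu : is_base_pmf M mu -> BL (Adm (base_family M R)) (usage M mu).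
Proof.
move=> pmf; split=> [e|rho [_ adm]]; first exact: usage_ge0.
case: pmf => mu0 _ mu1; rewrite usage_sum -[leLHS]mu1; apply: ler_sum => B bB.
rewrite ler_peMr // -sum_indicator.
have := adm [ffun e => (e \in B)%:R]; under eq_bigr do rewrite ffunE.
by apply; exists B.
Qed.

(* First-order optimality: moving [mu] towards a point mass at [B] cannot
   decrease the squared norm of the usage. *)
Lemma MEO_optimal_base mu B : MEO_optimal M mu -> base M B ->
  \sum_e usage M mu e ^+ 2 <= \sum_(e in B) usage M mu e.
Proof.
move=> [[mu0 muN mu1] opt] bB; set eta := usage M mu.
pose d e := (e \in B)%:R - eta e.
pose nu t : {ffun {set E} -> R} := [ffun C => (1 - t) * mu C + t * (C == B)%:R].
have point : \sum_(C : {set E} | base M C) (C == B)%:R = 1 :> R.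
  by rewrite (bigD1 B) //= eqxx big1 ?addr0 // => C /andP[_ /negPf->].
have pmf_nu t : 0 <= t <= 1 -> is_base_pmf M (nu t).
  move=> /andP[t0 t1]; split=> [C|C bC|].
  - by rewrite ffunE addr_ge0 ?mulr_ge0 // subr_ge0.
  - rewrite ffunE muN // mulr0 add0r; case: eqP => [eqC|]; rewrite ?mulr0 //.
    by rewrite eqC bB in bC.
  under eq_bigr do rewrite ffunE.
  by rewrite big_split /= -!mulr_sumr mu1 point !mulr1 subrK.
have usage_nu t e : usage M (nu t) e = eta e + t * d e.
  rewrite ffunE; under eq_bigr do rewrite ffunE.
  rewrite big_split /= -!mulr_sumr /d /eta ffunE.
  rewrite [X in _ + t * X](_ : _ = (e \in B)%:R); first by lra.
  have [eB|eB] := boolP (e \in B).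
    by rewrite (bigD1 B) /= ?bB // eqxx big1 ?addr0 // => C /andP[_ /negPf->].
  rewrite big1 // => C /andP[_ eC]; case: eqP => // eqC.
  by rewrite -eqC eC in eB.
pose S := \sum_e eta e * d e; pose Q := \sum_e d e ^+ 2.
have Q0 : 0 <= Q by apply: sumr_ge0 => e _; apply: sqr_ge0.
have expand t : expected_overlap M (nu t) =
    \sum_e eta e ^+ 2 + (2 * t) * S + t ^+ 2 * Q.
  rewrite expected_overlap_usage /S /Q !mulr_sumr -!big_split /=.
  by apply: eq_bigr => e _; rewrite usage_nu; ring.
have SE : S = \sum_(e in B) eta e - \sum_e eta e ^+ 2.
  rewrite /S -sum_indicator -sumrB; apply: eq_bigr => e _; rewrite /d; ring.
rewrite -subr_ge0 -SE leNgt; apply/negP=> S0.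
have QS : 0 < Q - S by lra.
(* Since [S < 0 <= Q], this [t] lies in (0, 1] even when [Q = 0]; as [t * Q = (t - 1) * S], the
   overlap changes by [t * (1 + t) * S < 0]. *)
pose t := - S / (Q - S).
have t0 : 0 < t by rewrite divr_gt0 ?oppr_gt0.
have tQS : t * (Q - S) = - S by rewrite divfK // gt_eqF.
have t1 : t <= 1 by rewrite ler_pdivrMr // mul1r; lra.
have := opt (nu t) (pmf_nu t _); rewrite (ltW t0) t1 => /(_ isT).
rewrite expand expected_overlap_usage -/eta; nra.
Qed.

(** The [mu]-average of the base weights is exactly the lower bound valid for every base, so no
    charged base can exceed it. *)
Lemma MEO_support_min mu B : MEO_optimal M mu -> base M B -> 0 < mu B ->
  \sum_(e in B) usage M mu e = \sum_e usage M mu e ^+ 2.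
Proof.
move=> opt bB muB; have [[mu0 _ mu1] _] := opt; set s := \sum_e _.
pose gap C := mu C * (\sum_(e in C) usage M mu e - s).
have gap0 C : base M C -> 0 <= gap C.
  by move=> bC; rewrite mulr_ge0 // subr_ge0 MEO_optimal_base.
have gap_sum : \sum_(C : {set E} | base M C) gap C = 0.
  under eq_bigr do rewrite /gap mulrBr.
  rewrite sumrB -mulr_suml mu1 mul1r -usage_sum.
  by under eq_bigr do rewrite -expr2; rewrite subrr.
move/eqP: gap_sum; rewrite psumr_eq0 // => /allP/(_ B (mem_index_enum B)).
by rewrite bB mulf_eq0 gt_eqF //= subr_eq0 => /eqP.
Qed.

End Usage.

(** * Optimal densities and Fulkerson duals *)

Lemma Mod2_optimal_proj (R : realType) (F : finType)
    (Gamma : set {ffun F -> R}) (eta : {ffun F -> R}) :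
  Adm Gamma eta ->
  (forall rho, Adm Gamma rho -> \sum_e eta e ^+ 2 <= \sum_e eta e * rho e) ->
  Mod2_optimal Gamma eta.
Proof.
move=> adm proj; split=> // rho /proj le.
have : 0 <= \sum_e (rho e - eta e) ^+ 2.
  by apply: sumr_ge0 => e _; apply: sqr_ge0.
have -> : \sum_e (rho e - eta e) ^+ 2 =
    \sum_e rho e ^+ 2 - 2 * (\sum_e eta e * rho e) + \sum_e eta e ^+ 2.
  by rewrite mulr_sumr -sumrB -big_split; apply: eq_bigr => e _ /=; ring.
by lra.
Qed.

(** [Adm] and [BL] differ only in the order of the factors in the pairing. This supplies the dual
    family that witnesses homogeneity. *)
Lemma Fulkerson_dual_Adm (R : realType) (F : finType)
  (Gamma : set {ffun F -> R}) : Fulkerson_dual Gamma (Adm Gamma).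
Proof.
split=> [gamma [] // |]; apply/seteqP; split=> rho [rho0 adm]; split=> // g /adm;
  by under eq_bigr do rewrite mulrC.
Qed.

Theorem theorem4p2 (R : realType) (E : finType) (M : matroid E)
    (Bt : set {ffun E -> R}) (mu : {ffun {set E} -> R}) (etamin : R) :
  (0 < rank M [set: E]%SET)%N ->
  loopless M ->
  Fulkerson_dual (base_family M R) Bt ->
  MEO_optimal M mu ->
  let eta := usage M mu in
  is_minimum eta etamin ->
  let Y : {set E} := [set e | eta e == etamin]%SET in
  Mod2_optimal Bt eta /\
  \sum_(e in Y) eta e = (rank M Y)%:R /\
  cl M Y = Y /\
  (etamin = (rank M Y)%:R / #|Y|%:R /\ 0 < etamin) /\
  etamin = 1 / fractional_arboricity M R /\
  homogeneous R (deletion M (~: Y)).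
Proof.
move=> _ lM [_ FD] opt eta [[e0 eta_e0] min_eta] Y.
have [pmf _] := opt; have [mu0 _ mu1] := pmf.
pose s := \sum_e eta e ^+ 2.
have Y_e0 : e0 \in Y by rewrite inE eta_e0.
have rY : (0 < rank M Y)%N := rank_loopless_gt0 lM Y_e0.
have cardY : (0 < #|Y|)%N by apply/card_gt0P; exists e0.
have supp B : base M B -> 0 < mu B -> #|B :&: Y| = rank M Y.
  move=> bB muB; apply: min_weight_base_argmin => // B' bB'.
  by rewrite (MEO_support_min opt bB muB) MEO_optimal_base.
have etaY : \sum_(e in Y) eta e = (rank M Y)%:R.
  rewrite usage_sum_set -[RHS]mul1r -[X in X * _]mu1 mulr_suml.
  apply: eq_bigr => B bB.
  have [muB|] := ltP 0 (mu B); first by rewrite supp.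
  by move=> muB; rewrite (le_anti (introT andP (conj muB (mu0 B)))) !mul0r.
have etaYc : \sum_(e in Y) eta e = etamin * #|Y|%:R.
  by rewrite mulr_natr -sumr_const; apply: eq_bigr => e; rewrite inE => /eqP.
have cardYR : 0 < #|Y|%:R :> R by rewrite ltr0n.
have rYR : 0 < (rank M Y)%:R :> R by rewrite ltr0n.
have minE : etamin = (rank M Y)%:R / #|Y|%:R.
  by rewrite -etaY etaYc mulfK // gt_eqF.
have min_gt0 : 0 < etamin by rewrite minE divr_gt0.
have s_gt0 : 0 < s.
  rewrite /s (bigD1 e0) //= eta_e0 ltr_pwDl ?exprn_gt0 //.
  by apply: sumr_ge0 => e _; apply: sqr_ge0.
split.
  apply: Mod2_optimal_proj; first by rewrite FD; apply: usage_BL.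
  (* Every base has [eta]-weight at least [s], so [eta / s] is admissible; testing [rho] against it
     bounds the pairing with [eta] below by [s]. *)
  rewrite FD => rho [_ /(_ [ffun e => eta e / s])].
  have -> : \sum_e rho e * [ffun e => eta e / s] e = (\sum_e eta e * rho e) / s.
    by rewrite mulr_suml; apply: eq_bigr => e _; rewrite ffunE; ring.
  rewrite ler_pdivlMr // mul1r; apply; split=> [e|_ [B bB <-]].
    by rewrite ffunE divr_ge0 ?usage_ge0 // ltW.
  rewrite (_ : \sum_e _ = (\sum_(e in B) eta e) / s).
    by rewrite ler_pdivlMr // mul1r; apply: MEO_optimal_base.
  rewrite -sum_indicator mulr_suml.
  by apply: eq_bigr => e _; rewrite !ffunE mulrA.
split=> //; split.
  apply/setP=> y; rewrite inE; apply/eqP/idP=> [rk|yY]; last first.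
    by rewrite (setUidPr _) // sub1set.
  (* Adding [y] without raising the rank would force [eta y <= 0], against [0 < etamin]. *)
  apply: contraT => yY; have := usage_set_le_rank (y |: Y) pmf.
  rewrite -/eta big_setU1 //= etaY rk gerDr => /(le_trans (min_eta y)).
  by rewrite leNgt min_gt0.
split=> //; split.
  rewrite div1r; apply: invr_inj; rewrite invrK; apply/eqP; rewrite eq_le.
  apply/andP; split.
    (* The set [Y] itself attains the ratio [1 / etamin]. *)
    rewrite minE invf_div /fractional_arboricity.
    exact: (@le_bigmax_cond _ _ _ _ Y (fun X => 0 < rank M X)%N
      (fun X => #|X|%:R / (rank M X)%:R)).
  (* Conversely, [etamin * #|X| <= eta(X) <= r(X)] for every [X]; the default 0 of the maximum is
     also below the bound. *)
  apply: bigmax_le => [|X rX]; first by rewrite invr_ge0 ltW.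
  rewrite ler_pdivrMr ?ltr0n // ler_pdivlMl //.
  apply: le_trans (usage_set_le_rank X pmf).
  rewrite mulr_natr -sumr_const; exact: ler_sum.
set N := deletion M (~: Y); pose F : finType := {e : E | e \notin ~: Y}.
have sum_val (w : E -> R) : \sum_(f : F) w (val f) = \sum_(e in Y) w e.
  rewrite -(big_preimset_val w (subxx Y)); apply: eq_bigl => f.
  by rewrite !inE; have := valP f; rewrite inE negbK inE.
pose c : {ffun F -> R} := [ffun => etamin].
have cardF : #|F| = #|Y|.
  by rewrite card_sig; apply: eq_card => e; rewrite !inE negbK.
have [_ NFDeq] := Fulkerson_dual_Adm (base_family N R).
exists (Adm (base_family N R)), c; split; first exact: Fulkerson_dual_Adm.
  2: by exists etamin => f; rewrite ffunE.
apply: Mod2_optimal_proj.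
  rewrite NFDeq; split=> [f|rho [rho0 adm]]; first by rewrite ffunE ltW.
  (* Extending [rho] by 0 off [Y] lets the pairing be averaged over the bases of [M]. *)
  pose w e := oapp rho 0 (insub e).
  have wE f : w (val f) = rho f by rewrite /w valK.
  have -> : \sum_f c f * rho f = \sum_e eta e * ((e \in Y)%:R * w e).
    under eq_bigr do rewrite -wE ffunE.
    rewrite (sum_val (fun e => etamin * w e)) -sum_indicator.
    apply: eq_bigr => e _; rewrite mulrCA inE; case: eqP => [->|_] //.
    by rewrite !mul0r !mulr0.
  rewrite usage_sum -[leLHS]mu1; apply: ler_sum => B bB.
  have [muB|] := ltP 0 (mu B); last first.
    by move=> muB; rewrite (le_anti (introT andP (conj muB (mu0 B)))) !mul0r.
  rewrite ler_peMr //.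
  (* The trace of a charged base is a base of [N], so [rho] gives it weight at least 1. *)
  have bBY := base_deletionC (base_indep bB) (supp B bB muB).
  have := adm [ffun f => (f \in (val @^-1: (B :&: Y) : {set F}))%:R].
  under eq_bigr do rewrite ffunE.
  rewrite sum_indicator; under eq_bigr do rewrite -wE.
  rewrite big_preimset_val ?subsetIr // => /(_ _)/le_trans->//.
    by exists (val @^-1: (B :&: Y)).
  rewrite le_eqVlt; apply/orP; left; apply/eqP.
  rewrite (eq_bigl (fun e => (e \in B) && (e \in Y))) => [|e]; last by rewrite inE.
  rewrite big_mkcondr; apply: eq_bigr => e _.
  by case: (e \in Y); rewrite (mul1r, mul0r).
(* All bases of [N] have [r(Y)] elements, so the constant [1 / r(Y)] is admissible and yields the
   bound on the total of [rho]. *)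
rewrite NFDeq => rho [_ /(_ [ffun => (rank M Y)%:R^-1])] adm.
have rho_sum : (rank M Y)%:R <= \sum_f rho f.
  move: adm; under eq_bigr do rewrite ffunE.
  rewrite -mulr_suml ler_pdivlMr // mul1r; apply; split=> [f|_ [B bB <-]].
    by rewrite ffunE invr_ge0 ltW.
  under eq_bigr do rewrite !ffunE.
  rewrite (sum_indicator B (fun=> (rank M Y)%:R^-1)) sumr_const.
  by rewrite -[leRHS]mulr_natl (card_base bB) rank_deletionC mulfV // gt_eqF.
under eq_bigr do rewrite ffunE.
rewrite sumr_const cardF -mulr_natr.
under eq_bigr do rewrite ffunE.
(* The squared norm of [c] is [etamin * (etamin * #|Y|) = etamin * r(Y)]. *)
by rewrite -mulr_sumr expr2 -mulrA -etaYc etaY ler_wpM2l // ltW.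
Qed.
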